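(* Let $\Lambda\in\mathbb{R}$ and let $a_0>0$, $\dot a_0\in\mathbb{R}$, $b_0>0$, $\dot b_0\in\mathbb{R}$, $\phi_0\in\mathbb{R}$, $\dot\phi_0>0$, $\rho_0\ge 0$ be initial data satisfying the initial constraint $$\left(\frac{\dot b_0}{b_0}\right)^2+2\frac{\dot a_0}{a_0}\frac{\dot b_0}{b_0}-\Lambda=8\pi\rho_0+4\pi\dot\phi_0^{\,2}.$$ Then the initial value problem for the Einstein-scalar field system on the Bianchi type I space-time with these initial data has a unique local solution: there exists $T>0$ such that there is one and only one solution $(a,b,\rho,\phi)$ on $[0,T)$ with these initial data.
   Context: Setting: the Bianchi type I space-time is $\mathbb{R}^4$ with metric $g=-dt^2+a(t)^2(dx^1)^2+b(t)^2[(dx^2)^2+(dx^3)^2]$, where $a>0$, $b>0$ are unknown functions of $t$. The unknown $\rho=\rho(t)\ge 0$ is the density of a co-moving pure-radiation perfect fluid, $\phi=\phi(t)$ is a real scalar field, and $\Lambda$ is the cosmological constant. An overdot denotes $d/dt$. In this setting the Einstein-scalar field system with cosmological constant $\Lambda$ is the following system of ordinary differential equations: the Hamiltonian constraint $$\left(\frac{\dot b}{b}\right)^2+2\frac{\dot a}{a}\frac{\dot b}{b}-\Lambda=8\pi\rho+4\pi\dot\phi^2,$$ and the evolution equations $$\left(\frac{\dot b}{b}\right)^2+2\frac{\ddot b}{b}-\Lambda=-\frac{8\pi\rho}{3}-4\pi\dot\phi^2,$$ $$\frac{\ddot a}{a}+\frac{\dot a\dot b}{ab}+\frac{\ddot b}{b}-\Lambda=-\frac{8\pi\rho}{3}-4\pi\dot\phi^2,$$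 $$\ddot\phi\,\dot\phi+\left(\frac{\dot a}{a}+2\frac{\dot b}{b}\right)\dot\phi^2=0,$$ $$\dot\rho+\frac43\left(\frac{\dot a}{a}+2\frac{\dot b}{b}\right)\rho=0.$$ A solution on $[0,T)$, $0<T\le+\infty$, with initial data $(a_0,\dot a_0,b_0,\dot b_0,\phi_0,\dot\phi_0,\rho_0)$ is a quadruple $(a,b,\rho,\phi)$ of real functions on $[0,T)$ with $a,b,\phi$ of class $C^2$, $\rho$ of class $C^1$, $a>0$, $b>0$, $\rho\ge0$, $\dot\phi\ge 0$ (the scalar field is sought non-decreasing), satisfying all the equations above on $[0,T)$ and $a(0)=a_0$, $\dot a(0)=\dot a_0$, $b(0)=b_0$, $\dot b(0)=\dot b_0$, $\phi(0)=\phi_0$, $\dot\phi(0)=\dot\phi_0$, $\rho(0)=\rho_0$. *)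

(* Defs.v *)
From Stdlib Require Import Reals.
From Coquelicot Require Import Coquelicot.
Open Scope R_scope.

(* The half-open interval [0, T), where T may be +oo. *)
Definition interval (T : Rbar) (t : R) : Prop := 0 <= t /\ Rbar_lt t T.

(* On [0, T) derivatives and continuity are taken relative to the interval
   ([D_in], [continue_in]), hence one-sided at t = 0; the values of the total
   functions outside the interval are irrelevant. *)
Definition is_C1_on (D : R -> Prop) (f f' : R -> R) : Prop :=
  forall t : R, D t -> D_in f f' D t /\ continue_in f' D t.

Definition is_C2_on (D : R -> Prop) (f f' f'' : R -> R) : Prop :=
  is_C1_on D f f' /\ is_C1_on D f' f''.

(* Pointwise equations: [da], [dda], etc. stand for the values of the first and
   second time derivatives at a given time. *)
Definition hamiltonian_constraint (Lambda a da b db dphi rho : R) : Prop :=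
  (db / b) ^ 2 + 2 * (da / a) * (db / b) - Lambda
  = 8 * PI * rho + 4 * PI * dphi ^ 2.

Definition evolution_b (Lambda b db ddb dphi rho : R) : Prop :=
  (db / b) ^ 2 + 2 * (ddb / b) - Lambda
  = - (8 * PI * rho / 3) - 4 * PI * dphi ^ 2.

Definition evolution_a (Lambda a da dda b db ddb dphi rho : R) : Prop :=
  dda / a + (da * db) / (a * b) + ddb / b - Lambda
  = - (8 * PI * rho / 3) - 4 * PI * dphi ^ 2.

Definition evolution_phi (a da b db dphi ddphi : R) : Prop :=
  ddphi * dphi + (da / a + 2 * (db / b)) * dphi ^ 2 = 0.

Definition evolution_rho (a da b db rho drho : R) : Prop :=
  drho + 4 / 3 * (da / a + 2 * (db / b)) * rho = 0.

Definition is_solution (Lambda : R) (T : Rbar)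
    (a0 da0 b0 db0 phi0 dphi0 rho0 : R) (a b rho phi : R -> R) : Prop :=
  exists a' a'' b' b'' phi' phi'' rho' : R -> R,
    is_C2_on (interval T) a a' a'' /\
    is_C2_on (interval T) b b' b'' /\
    is_C2_on (interval T) phi phi' phi'' /\
    is_C1_on (interval T) rho rho' /\
    (forall t : R, interval T t ->
       0 < a t /\ 0 < b t /\ 0 <= rho t /\ 0 <= phi' t /\
       hamiltonian_constraint Lambda (a t) (a' t) (b t) (b' t) (phi' t) (rho t) /\
       evolution_b Lambda (b t) (b' t) (b'' t) (phi' t) (rho t) /\
       evolution_a Lambda (a t) (a' t) (a'' t) (b t) (b' t) (b'' t)
         (phi' t) (rho t) /\
       evolution_phi (a t) (a' t) (b t) (b' t) (phi' t) (phi'' t) /\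
       evolution_rho (a t) (a' t) (b t) (b' t) (rho t) (rho' t)) /\
    a 0 = a0 /\ a' 0 = da0 /\ b 0 = b0 /\ b' 0 = db0 /\
    phi 0 = phi0 /\ phi' 0 = dphi0 /\ rho 0 = rho0.

(* Main.v *)
Require Import Defs.
From Stdlib Require Import Reals Lra Lia.
From Coquelicot Require Import Coquelicot.
Open Scope R_scope.

(* Let m = ln (a b^2 / (a0 b0^2)) and d = da0/a0 - db0/b0. The last two equations
   integrate to dphi/dt = dphi0 e^{-m} and rho = rho0 e^{-4m/3}; combining the
   constraint with the evolution equations gives
   (V x)' = (V y)' = V (Lambda + 8 PI rho / 3), where V = a b^2, x = a'/a and
   y = b'/b, whence x - y = d e^{-m}. Since m' = x + 2y, the constraint eliminates
   both Lambda and m'^2 from m'', leaving the autonomous scalar equation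
     m'' = - 16 PI rho0 e^{-4m/3} - (d^2 + 12 PI dphi0^2) e^{-2m}
   with locally Lipschitz right-hand side: it is solved by Picard iteration, and
   is unique by a Gronwall estimate. Conversely x, y, dphi/dt and rho are explicit
   in m and m', and the constraint is the energy integral of this equation. *)

(* [auto_derive] leaves [Derive (fun x => f x) t] for an abstract [f]. *)
Ltac rewrite_derivatives :=
  repeat match goal with
  | H : is_derive ?f ?t ?l |- context [Derive ?g ?t] =>
      replace (Derive g t) with l by (symmetry; exact (is_derive_unique f t l H))
  end.

(** * Lipschitz functions, clipping and primitives *)

Definition locally_lipschitz (F : R -> R) : Prop :=
  forall M : R, exists L : R, 0 < L /\
    forall x y : R, Rabs x <= M -> Rabs y <= M ->
      Rabs (F x - F y) <= L * Rabs (x - y).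

Definition globally_lipschitz (L : R) (F : R -> R) : Prop :=
  forall x y : R, Rabs (F x - F y) <= L * Rabs (x - y).

(** For [0 <= r], the projection onto [[-r, r]]. Applied to values it makes a locally Lipschitz
    function globally Lipschitz; applied to times it confines the iteration to a short interval. *)
Definition clip (r x : R) : R := Rmax (- r) (Rmin x r).

Lemma clip_bound (r x : R) : 0 <= r -> Rabs (clip r x) <= r.
Proof.
  intros Hr. unfold clip, Rmax, Rmin.
  repeat destruct (Rle_dec _ _); apply Rabs_le; lra.
Qed.

Lemma clip_id (r x : R) : Rabs x <= r -> clip r x = x.
Proof.
  intros Hx. apply Rabs_le_between in Hx. unfold clip, Rmax, Rmin.
  repeat destruct (Rle_dec _ _); lra.
Qed.

Lemma clip_lipschitz (r : R) : globally_lipschitz 1 (clip r).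
Proof.
  intros x y. unfold clip, Rmax, Rmin.
  repeat destruct (Rle_dec _ _); unfold Rabs; repeat destruct (Rcase_abs _); lra.
Qed.

Lemma lipschitz_continuous (L : R) (F : R -> R) (x : R) :
  globally_lipschitz L F -> continuous F x.
Proof.
  intros HF. apply continuity_pt_filterlim. intros eps Heps.
  (* The sign of [L] is unknown; [Rabs L + 1] is positive and dominates it. *)
  exists (eps / (Rabs L + 1)).
  assert (HL := Rabs_pos L).
  split.
  - apply Rdiv_lt_0_compat; lra.
  - intros y [_ Hy]. simpl in *. unfold Rdist in *.
    apply Rle_lt_trans with (1 := HF y x).
    apply Rle_lt_trans with ((Rabs L + 1) * Rabs (y - x)).
    + apply Rmult_le_compat_r; [apply Rabs_pos|]. generalize (Rle_abs L); lra.
    + apply Rlt_le_trans with ((Rabs L + 1) * (eps / (Rabs L + 1))).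
      * apply Rmult_lt_compat_l; lra.
      * right; field; lra.
Qed.

Lemma is_derive_primitive (f : R -> R) (t : R) :
  (forall s, continuous f s) -> is_derive (fun s => RInt f 0 s) t (f t).
Proof.
  intros Hf. apply (is_derive_RInt f _ 0 t); [|apply Hf].
  apply filter_forall. intros s. apply (@RInt_correct R_CompleteNormedModule).
  apply (@ex_RInt_continuous R_CompleteNormedModule). intros; apply Hf.
Qed.

Lemma derive_continuous (f : R -> R) (t l : R) :
  is_derive f t l -> continuous f t.
Proof. intros H. apply (@ex_derive_continuous R_AbsRing R_NormedModule). now exists l. Qed.

(** * Picard iteration for y'' = F(y) *)

(** The solution of [y'' = f], [y(0) = v0], [y'(0) = v1]. It turns the second-order problem into a
    scalar integral equation, with no passage to a first-order system. *)
Definition primitive2 (v0 v1 : R) (f : R -> R) (t : R) : R :=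
  v0 + v1 * t + RInt (fun s => RInt f 0 s) 0 t.

Section Primitive2.

Variables (v0 v1 : R) (f : R -> R).
Hypothesis f_continuous : forall s, continuous f s.

Lemma primitive2_0 : primitive2 v0 v1 f 0 = v0.
Proof.
  unfold primitive2. rewrite RInt_point. unfold zero; simpl; ring.
Qed.

Lemma is_derive_primitive2 (t : R) :
  is_derive (primitive2 v0 v1 f) t (v1 + RInt f 0 t).
Proof.
  unfold primitive2. apply (is_derive_plus (fun t => v0 + v1 * t)).
  - auto_derive; [easy|ring].
  - apply (is_derive_primitive (fun s => RInt f 0 s)). intros s.
    now apply derive_continuous with (f s), is_derive_primitive.
Qed.

Lemma is_derive2_primitive2 (t : R) :
  is_derive (fun s => v1 + RInt f 0 s) t (f t).
Proof.
  replace (f t) with (0 + f t) by ring.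
  apply (is_derive_plus (fun _ => v1)).
  - apply is_derive_Reals, derivable_pt_lim_const.
  - now apply is_derive_primitive.
Qed.

End Primitive2.

(** Mean value theorem between 0 and [t]. Used twice in a row, it bounds a double primitive by
    [K * T * T]. *)
Lemma derive_bound (w w' : R -> R) (K T : R) :
  (forall t, is_derive w t (w' t)) -> w 0 = 0 ->
  (forall t, Rabs t <= T -> Rabs (w' t) <= K) ->
  forall t, Rabs t <= T -> Rabs (w t) <= K * T.
Proof.
  intros Hw H0 HK t Ht.
  destruct (MVT_abs w w' 0 t) as [c [Hc Hcb]].
  { intros c _. now apply is_derive_Reals. }
  rewrite H0, !Rminus_0_r in Hc. rewrite Hc.
  apply Rmult_le_compat; try apply Rabs_pos; trivial.
  apply HK. apply Rle_trans with (2 := Ht).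
  rewrite <- (Rminus_0_r c), <- (Rminus_0_r t).
  apply Rabs_le_between_min_max. now rewrite Rmin_comm, Rmax_comm.
Qed.

(** The initial data cancel, so the difference and its derivative both vanish at 0 and
    [derive_bound] applies to each. *)
Lemma primitive2_dist (v0 v1 : R) (f g : R -> R) (K T : R) :
  (forall s, continuous f s) -> (forall s, continuous g s) ->
  (forall s, Rabs (f s - g s) <= K) ->
  forall t, Rabs t <= T ->
    Rabs (primitive2 v0 v1 f t - primitive2 v0 v1 g t) <= K * T * T.
Proof.
  intros Hf Hg HK.
  apply (derive_bound (fun t => primitive2 v0 v1 f t - primitive2 v0 v1 g t)
    (fun t => (v1 + RInt f 0 t) - (v1 + RInt g 0 t))).
  - intros t. apply (is_derive_minus (primitive2 v0 v1 f));
      now apply is_derive_primitive2.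
  - rewrite !primitive2_0. ring.
  - apply (derive_bound (fun t => (v1 + RInt f 0 t) - (v1 + RInt g 0 t))
      (fun t => f t - g t)).
    + intros t. apply (is_derive_minus (fun t => v1 + RInt f 0 t));
        now apply is_derive2_primitive2.
    + rewrite !RInt_point. ring.
    + intros t _. apply HK.
Qed.

Section Picard.

Variables (F : R -> R) (L T v0 v1 : R).
Hypothesis F_lipschitz : globally_lipschitz L F.
Hypothesis T_pos : 0 < T.
Hypothesis L_nonneg : 0 <= L.
Hypothesis contraction : L * T * T <= / 2.

(* Clipping time to [-T, T] makes the contraction estimate uniform over R. *)
Definition picard_map (u : R -> R) (t : R) : R :=
  primitive2 v0 v1 (fun s => F (u s)) (clip T t).

Fixpoint picard (n : nat) : R -> R :=
  match n with
  | O => fun _ => v0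
  | S n => picard_map (picard n)
  end.

Lemma continuous_F_comp (u : R -> R) :
  (forall s, continuous u s) -> forall s, continuous (fun s => F (u s)) s.
Proof.
  intros Hu s. apply (continuous_comp u F); [apply Hu|].
  now apply lipschitz_continuous with L.
Qed.

Lemma picard_map_continuous (u : R -> R) :
  (forall s, continuous u s) -> forall s, continuous (picard_map u) s.
Proof.
  intros Hu s. apply (continuous_comp (clip T) (primitive2 v0 v1 (fun s => F (u s)))).
  - apply lipschitz_continuous with 1, clip_lipschitz.
  - eapply derive_continuous, is_derive_primitive2. now apply continuous_F_comp.
Qed.

Lemma picard_continuous (n : nat) : forall s, continuous (picard n) s.
Proof.
  induction n as [|n IH].
  - intros s. apply continuous_const.
  - now apply picard_map_continuous.
Qed.

(** [F] costs a factor [L] and the two integrations a factor [T * T]; their product is at most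
    1/2. *)
Lemma picard_map_dist (u v : R -> R) (K : R) :
  (forall s, continuous u s) -> (forall s, continuous v s) ->
  (forall s, Rabs (u s - v s) <= K) ->
  forall t, Rabs (picard_map u t - picard_map v t) <= K / 2.
Proof.
  intros Hu Hv HK t.
  assert (HK0 : 0 <= K) by (apply Rle_trans with (2 := HK 0), Rabs_pos).
  apply Rle_trans with (L * K * T * T).
  - apply primitive2_dist; try now apply continuous_F_comp.
    + intros s. apply Rle_trans with (1 := F_lipschitz _ _).
      now apply Rmult_le_compat_l.
    + apply clip_bound; lra.
  - replace (L * K * T * T) with (K * (L * T * T)) by ring.
    now apply Rmult_le_compat_l.
Qed.

Lemma picard_step_bound : exists M : R, 0 < M /\
  forall n t, Rabs (picard (S n) t - picard n t) <= M * (/ 2) ^ n.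
Proof.
  (* Bound for the first step, whose derivative is [v1 + F v0 * t]. The later [M + 1] makes the
     constant strictly positive, so that it can be divided by. *)
  set (M := (Rabs v1 + Rabs (F v0) * T) * T).
  assert (HM : 0 <= M).
  { apply Rmult_le_pos; [|lra]. apply Rplus_le_le_0_compat; [apply Rabs_pos|].
    apply Rmult_le_pos; [apply Rabs_pos|lra]. }
  exists (M + 1). split; [lra|].
  induction n as [|n IH]; intros t.
  - simpl. rewrite Rmult_1_r. apply Rle_trans with M; [|lra].
    unfold picard_map, M. generalize (clip_bound T t (Rlt_le _ _ T_pos)).
    apply (derive_bound (fun t => primitive2 v0 v1 (fun _ => F v0) t - v0)
      (fun t => v1 + RInt (fun _ => F v0) 0 t)).
    + intros s. replace (v1 + _) with ((v1 + RInt (fun _ => F v0) 0 s) - 0) by apply Rminus_0_r.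
      apply (is_derive_minus (primitive2 v0 v1 (fun _ => F v0)) (fun _ => v0)).
      * apply is_derive_primitive2. intros; apply continuous_const.
      * apply is_derive_Reals, derivable_pt_lim_const.
    + rewrite primitive2_0. ring.
    + intros s Hs. apply Rle_trans with (1 := Rabs_triang _ _).
      apply Rplus_le_compat_l. rewrite RInt_const. unfold scal; simpl.
      unfold mult; simpl. rewrite Rminus_0_r, Rabs_mult, Rmult_comm.
      apply Rmult_le_compat_l; [apply Rabs_pos|trivial].
  - replace ((M + 1) * (/ 2) ^ S n) with ((M + 1) * (/ 2) ^ n / 2) by (simpl; field).
    apply (picard_map_dist (picard (S n)) (picard n)); trivial;
      intros; apply picard_continuous.
Qed.

Lemma picard_cauchy : CVU_cauchy picard (fun _ => True).
Proof.
  destruct picard_step_bound as [M [HM Hstep]].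
  (* Telescoping sum of the step bounds; keeping the factor [1 - (/ 2) ^ k] of the finite geometric
     sum lets the induction on [k] close. *)
  assert (Htail : forall n k t,
    Rabs (picard (n + k) t - picard n t) <= 2 * M * (/ 2) ^ n * (1 - (/ 2) ^ k)).
  { intros n k t. induction k as [|k IH].
    - rewrite Nat.add_0_r, Rminus_diag, Rabs_R0. simpl; lra.
    - replace (picard (n + S k) t - picard n t)
        with ((picard (S (n + k)) t - picard (n + k) t)
              + (picard (n + k) t - picard n t)) by (rewrite Nat.add_succ_r; ring).
      apply Rle_trans with (1 := Rabs_triang _ _).
      generalize (Hstep (n + k)%nat t). rewrite pow_add. simpl. lra. }
  intros [eps Heps]. simpl.
  destruct (pow_lt_1_zero (/ 2)) with (eps / (4 * M)) as [N HN].
  { rewrite Rabs_pos_eq; lra. }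
  { apply Rdiv_lt_0_compat; lra. }
  specialize (HN N (Nat.le_refl N)).
  assert (Hp : forall n, 0 < (/ 2) ^ n) by (intros; apply pow_lt; lra).
  rewrite Rabs_pos_eq in HN by (generalize (Hp N); lra).
  assert (HN' : 2 * M * (/ 2) ^ N < eps / 2).
  { apply Rlt_le_trans with (2 * M * (eps / (4 * M))).
    - apply Rmult_lt_compat_l; lra.
    - right; field; lra. }
  assert (Hclose : forall n t, (N <= n)%nat -> Rabs (picard n t - picard N t) < eps / 2).
  { intros n t Hn. apply Rle_lt_trans with (2 := HN').
    replace n with (N + (n - N))%nat by lia.
    apply Rle_trans with (1 := Htail _ _ _).
    rewrite <- Rmult_1_r. apply Rmult_le_compat_l.
    - generalize (Rmult_lt_0_compat _ _ HM (Hp N)); lra.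
    - generalize (Hp (n - N)%nat); lra. }
  exists N. intros n m t _ Hn Hm.
  replace (picard n t - picard m t)
    with ((picard n t - picard N t) - (picard m t - picard N t)) by ring.
  apply Rle_lt_trans with (1 := Rabs_triang _ _). rewrite Rabs_Ropp.
  generalize (Hclose n t Hn) (Hclose m t Hm); lra.
Qed.

(** The uniform limit of the iterates is continuous. Since [picard_map] contracts uniform distances,
    both [u] and [picard_map u] are arbitrarily close to a late iterate [picard (S N)], hence
    equal. *)
Lemma picard_fixpoint : exists u : R -> R,
  (forall t, continuous u t) /\ forall t, u t = picard_map u t.
Proof.
  assert (Hcv := proj2 (CVU_dom_cauchy _ _) picard_cauchy).
  set (u := fun t => real (Lim_seq (fun n => picard n t))).
  assert (Hu : forall t, continuous u t).
  { intros t. apply continuity_pt_filterlim.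
    apply (CVU_cont_open picard (fun _ => True) open_true Hcv); trivial.
    intros n s _. apply continuity_pt_filterlim, picard_continuous. }
  exists u. split; trivial.
  intros t. apply cond_eq. intros eps Heps.
  assert (Heps2 : 0 < eps / 2) by lra.
  destruct (Hcv (mkposreal _ Heps2)) as [N HN]. simpl in HN.
  replace (u t - picard_map u t) with
    ((picard_map (picard N) t - picard_map u t) - (picard (S N) t - u t))
    by (simpl; ring).
  apply Rle_lt_trans with (1 := Rabs_triang _ _). rewrite Rabs_Ropp.
  assert (H1 : Rabs (picard_map (picard N) t - picard_map u t) <= eps / 2 / 2).
  { apply picard_map_dist; trivial.
    - apply picard_continuous.
    - intros s. apply Rlt_le. now apply HN. }
  assert (H2 := HN (S N) ltac:(lia) t I). fold (u t) in H2. lra.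
Qed.

End Picard.

(** Picard iteration is run for [F] clipped to the ball of radius [Rabs v0 + 1]; by continuity the
    solution stays in that ball for a short time, during which the clipping is invisible. The
    function [m] is differentiable on all of R, though it solves the equation only near 0. *)
Lemma ode2_existence (F : R -> R) (v0 v1 : R) :
  locally_lipschitz F ->
  exists T : R, 0 < T /\ exists m m' : R -> R,
    m 0 = v0 /\ m' 0 = v1 /\
    (forall t, is_derive m t (m' t)) /\
    forall t, Rabs t < T -> is_derive m' t (F (m t)).
Proof.
  intros HF. set (r := Rabs v0 + 1).
  assert (Hr : 0 <= r) by (unfold r; generalize (Rabs_pos v0); lra).
  destruct (HF r) as [L [HL HFL]].
  set (G := fun x => F (clip r x)).
  assert (HG : globally_lipschitz L G).
  { intros x y. unfold G.
    apply Rle_trans with (L * Rabs (clip r x - clip r y)).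
    - apply HFL; now apply clip_bound.
    - apply Rmult_le_compat_l; [lra|]. rewrite <- (Rmult_1_l (Rabs (x - y))).
      apply clip_lipschitz. }
  (* This gives [(L + 1) * T = / 2] and [T <= 1], hence [L * T * T <= L * T <= / 2]. *)
  set (T := / (2 * (L + 1))).
  assert (HT : 0 < T) by (apply Rinv_0_lt_compat; lra).
  assert (HLT : L * T * T <= / 2).
  { assert (H1 : (L + 1) * T = / 2) by (unfold T; field; lra).
    assert (H2 : 0 < L * T) by now apply Rmult_lt_0_compat.
    assert (H3 : L * T * T <= L * T * 1) by (apply Rmult_le_compat_l; lra).
    lra. }
  destruct (picard_fixpoint G L T v0 v1 HG HT (Rlt_le _ _ HL) HLT) as [u [Hu Hfix]].
  assert (HGu : forall s, continuous (fun s => G (u s)) s)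
    by now apply continuous_F_comp with L.
  (* The same integral as the fixed point [u], without clipping of time: it is differentiable
     everywhere and equals [u] on [[-T, T]]. *)
  set (m := primitive2 v0 v1 (fun s => G (u s))).
  assert (Hm0 : m 0 = v0) by apply primitive2_0.
  assert (Hm : forall t, is_derive m t (v1 + RInt (fun s => G (u s)) 0 t))
    by (intros; now apply is_derive_primitive2).
  assert (Hball : locally 0 (fun t => Rabs (m t - v0) < 1)).
  { rewrite <- Hm0. apply (derive_continuous _ _ _ (Hm 0) (fun x => Rabs (x - m 0) < 1)).
    exists (mkposreal 1 Rlt_0_1). intros y Hy. apply Hy. }
  destruct Hball as [[d Hd] Hball].
  exists (Rmin T d). split; [now apply Rmin_pos|].
  exists m, (fun t => v1 + RInt (fun s => G (u s)) 0 t).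
  split; [|split; [|split]]; trivial.
  - rewrite RInt_point. unfold zero; simpl; ring.
  - intros t Ht.
    replace (F (m t)) with (G (u t)).
    { exact (is_derive2_primitive2 v1 _ HGu t). }
    rewrite Hfix. unfold picard_map, G.
    rewrite (clip_id T t) by (generalize (Rmin_l T d); lra).
    fold m. rewrite clip_id; trivial.
    assert (Hmt : Rabs (m t - v0) < 1).
    { apply Hball. unfold ball; simpl; unfold AbsRing_ball, abs, minus, plus, opp; simpl.
      rewrite Ropp_0, Rplus_0_r. apply Rlt_le_trans with (1 := Ht), Rmin_r. }
    change (Rabs (m t) <= r). unfold r.
    generalize (Rabs_triang_inv (m t) v0); lra.
Qed.

(** * Uniqueness *)

Lemma nonincreasing_on_interval (f f' : R -> R) (T : R) :
  (forall t, 0 <= t < T -> is_derive f t (f' t)) ->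
  (forall t, 0 <= t < T -> f' t <= 0) ->
  forall t, 0 <= t < T -> f t <= f 0.
Proof.
  intros Hf Hle t Ht.
  destruct (MVT_gen f 0 t f') as [c [Hc Heq]].
  - rewrite Rmin_left, Rmax_right by lra. intros; apply Hf; lra.
  - rewrite Rmin_left, Rmax_right by lra. intros.
    apply continuity_pt_filterlim. eapply derive_continuous, Hf; lra.
  - rewrite Rmin_left, Rmax_right in Hc by lra.
    assert (H := Hle c ltac:(lra)).
    generalize (Rmult_le_compat_r t (f' c) 0 ltac:(lra) H); lra.
Qed.

Lemma constant_on_interval (f : R -> R) (T : R) :
  (forall t, 0 <= t < T -> is_derive f t 0) ->
  forall t, 0 <= t < T -> f t = f 0.
Proof.
  intros Hf t Ht. apply Rle_antisym.
  - apply (nonincreasing_on_interval f (fun _ => 0) T); trivial. intros; lra.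
  - apply Ropp_le_cancel.
    apply (nonincreasing_on_interval (fun t => - f t) (fun _ => 0) T); trivial.
    + intros s Hs. replace 0 with (- 0) by ring.
      now apply (is_derive_opp f), Hf.
    + intros; lra.
Qed.

Lemma bounded_on_segment (f : R -> R) (a b : R) :
  a <= b -> (forall s, a <= s <= b -> continuous f s) ->
  exists M : R, forall s, a <= s <= b -> Rabs (f s) <= M.
Proof.
  intros Hab Hf.
  destruct (continuity_ab_maj (fun s => Rabs (f s)) a b Hab) as [x [Hx _]].
  - intros c Hc. apply (continuity_pt_comp f Rabs).
    + now apply continuity_pt_filterlim, Hf.
    + apply Rcontinuity_abs.
  - now exists (Rabs (f x)).
Qed.

Lemma locally_lipschitz_C1 (F F' : R -> R) :
  (forall x, is_derive F x (F' x)) -> (forall x, continuous F' x) ->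
  locally_lipschitz F.
Proof.
  intros HF HF' M.
  (* [M] may be negative; [Rabs M] gives a nonempty segment on which to bound [F']. *)
  assert (HM := Rabs_pos M). assert (HM' := Rle_abs M).
  destruct (bounded_on_segment F' (- Rabs M) (Rabs M)) as [L HL]; [lra|trivial|].
  exists (Rabs L + 1). split; [generalize (Rabs_pos L); lra|].
  intros x y Hx Hy.
  destruct (MVT_abs F F' y x) as [c [Hc Hcb]].
  { intros c _. now apply is_derive_Reals. }
  rewrite Hc. apply Rmult_le_compat_r; [apply Rabs_pos|].
  apply Rabs_le_between in Hx, Hy.
  apply Rle_trans with L; [|generalize (Rle_abs L); lra].
  apply HL. destruct Hcb as [Hc1 Hc2].
  split.
  - apply Rle_trans with (2 := Hc1), Rmin_glb; lra.
  - apply Rle_trans with (1 := Hc2), Rmax_lub; lra.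
Qed.

(** Gronwall: with [w = m1 - m2], the derivative of [w^2 + w'^2] is at most [2 (1 + L) |w| |w'|],
    hence at most [(1 + L) (w^2 + w'^2)]. The weighted energy [g] is therefore nonincreasing; it
    starts at 0 and is nonnegative. *)
Lemma ode2_uniqueness (F : R -> R) (T : R) (m1 m1' m2 m2' : R -> R) :
  locally_lipschitz F ->
  m1 0 = m2 0 -> m1' 0 = m2' 0 ->
  (forall t, 0 <= t < T -> is_derive m1 t (m1' t)) ->
  (forall t, 0 <= t < T -> is_derive m1' t (F (m1 t))) ->
  (forall t, 0 <= t < T -> is_derive m2 t (m2' t)) ->
  (forall t, 0 <= t < T -> is_derive m2' t (F (m2 t))) ->
  forall t, 0 <= t < T -> m1 t = m2 t /\ m1' t = m2' t.
Proof.
  intros HF H0 H0' D1 D1' D2 D2' t0 Ht0.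
  (* A time strictly between [t0] and [T]: both solutions are bounded on the compact [[0, t]], and
     [t0] lies in [[0, t)]. *)
  set (t := (t0 + T) / 2).
  assert (Ht : t0 < t < T) by (unfold t; lra).
  destruct (bounded_on_segment m1 0 t) as [M1 HM1]; [lra| |].
  { intros s Hs. eapply derive_continuous, D1; lra. }
  destruct (bounded_on_segment m2 0 t) as [M2 HM2]; [lra| |].
  { intros s Hs. eapply derive_continuous, D2; lra. }
  destruct (HF (Rmax M1 M2)) as [L [HL HFL]].
  set (w := fun s => m1 s - m2 s). set (w' := fun s => m1' s - m2' s).
  set (g := fun s => (w s ^ 2 + w' s ^ 2) * exp (- (1 + L) * s)).
  assert (Hg : forall s, 0 <= s < t -> g s <= g 0).
  { apply (nonincreasing_on_interval g (fun s =>
      (2 * w s * w' s + 2 * w' s * (F (m1 s) - F (m2 s))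
        - (1 + L) * (w s ^ 2 + w' s ^ 2)) * exp (- (1 + L) * s))).
    - intros s Hs.
      assert (E1 := D1 s ltac:(lra)). assert (E1' := D1' s ltac:(lra)).
      assert (E2 := D2 s ltac:(lra)). assert (E2' := D2' s ltac:(lra)).
      unfold g, w, w'. auto_derive.
      + repeat split; eexists; eassumption.
      + rewrite_derivatives. ring.
    - intros s Hs. rewrite <- (Rmult_0_l (exp (- (1 + L) * s))).
      apply Rmult_le_compat_r; [apply Rlt_le, exp_pos|].
      assert (HB : Rabs (F (m1 s) - F (m2 s)) <= L * Rabs (w s)).
      { apply HFL.
        - apply Rle_trans with (2 := Rmax_l _ _), HM1; lra.
        - apply Rle_trans with (2 := Rmax_r _ _), HM2; lra. }
      assert (HC : w' s * (F (m1 s) - F (m2 s)) <= L * (Rabs (w s) * Rabs (w' s))).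
      { apply Rle_trans with (1 := Rle_abs _). rewrite Rabs_mult.
        generalize (Rmult_le_compat_l _ _ _ (Rabs_pos (w' s)) HB); lra. }
      rewrite <- (pow2_abs (w s)), <- (pow2_abs (w' s)).
      assert (HD : w s * w' s <= Rabs (w s) * Rabs (w' s)).
      { rewrite <- Rabs_mult. apply Rle_abs. }
      assert (HE : 2 * (Rabs (w s) * Rabs (w' s)) <= Rabs (w s) ^ 2 + Rabs (w' s) ^ 2)
        by (generalize (pow2_ge_0 (Rabs (w s) - Rabs (w' s))); lra).
      generalize (Rmult_le_compat_l _ _ _ (Rlt_le _ _ HL) HE); lra. }
  assert (Hg0 : g 0 = 0) by (unfold g, w, w'; rewrite H0, H0'; ring).
  assert (Hgt := Hg t0 ltac:(lra)). rewrite Hg0 in Hgt. unfold g in Hgt.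
  assert (Hexp := exp_pos (- (1 + L) * t0)).
  assert (HE : w t0 ^ 2 + w' t0 ^ 2 <= 0).
  { apply Rmult_le_reg_r with (1 := Hexp). lra. }
  generalize (pow2_ge_0 (w t0)) (pow2_ge_0 (w' t0)); intros P1 P2.
  assert (W1 : w t0 = 0) by (apply Rsqr_0_uniq; unfold Rsqr; lra).
  assert (W2 : w' t0 = 0) by (apply Rsqr_0_uniq; unfold Rsqr; lra).
  unfold w, w' in W1, W2. lra.
Qed.

(** * One-sided derivatives *)

Lemma is_C1_on_intro (D : R -> Prop) (f f' : R -> R) :
  (forall t, D t -> is_derive f t (f' t)) ->
  (forall t, D t -> continuous f' t) -> is_C1_on D f f'.
Proof.
  intros Hf Hf' t Ht. split.
  - apply limit1_imp with (D_x no_cond t).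
    + intros s [_ Hs]. now split.
    + now apply (derivable_pt_lim_D_in f f' t), is_derive_Reals, Hf.
  - apply limit1_imp with (D_x no_cond t).
    + intros s [_ Hs]. now split.
    + now apply continuity_pt_filterlim, Hf'.
Qed.

(* Extending [f] affinely to the left of 0 turns the one-sided derivative at 0
   into a two-sided one. *)
Lemma is_C1_on_extension (T : R) (f f' : R -> R) :
  is_C1_on (interval T) f f' ->
  exists g : R -> R, forall t, 0 <= t < T -> g t = f t /\ is_derive g t (f' t).
Proof.
  intros Hf.
  set (g := fun t => if Rle_dec 0 t then f t else f 0 + f' 0 * t).
  assert (Hg : forall t, 0 <= t -> g t = f t).
  { intros t Ht. unfold g. now destruct (Rle_dec 0 t). }
  exists g. intros t Ht. split; [now apply Hg|].
  apply is_derive_Reals. intros eps Heps.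
  destruct (Hf t Ht) as [Hd _].
  destruct (Hd eps Heps) as [alp [Halp Hlim]].
  (* For [t > 0], increments shorter than [d] keep [t + k] positive, so the affine piece is met only
     when [t = 0]. *)
  assert (Hright : exists d, 0 < d /\ (0 < t -> d <= t)).
  { destruct (Rlt_dec 0 t); [exists t|exists 1]; lra. }
  destruct Hright as [d [Hd0 Hdt]].
  assert (Hdelta : 0 < Rmin alp (Rmin d (T - t))) by (repeat apply Rmin_pos; lra).
  exists (mkposreal _ Hdelta). simpl. intros k Hk Hkd.
  assert (Hk1 := Rlt_le_trans _ _ _ Hkd (Rmin_l _ _)).
  assert (Hk2 := Rlt_le_trans _ _ _ Hkd (Rmin_r _ _)).
  assert (Hk3 := Rlt_le_trans _ _ _ Hk2 (Rmin_l _ _)).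
  assert (Hk4 := Rlt_le_trans _ _ _ Hk2 (Rmin_r _ _)).
  apply Rabs_lt_between in Hk3, Hk4.
  rewrite (Hg t) by lra.
  destruct (Rle_dec 0 (t + k)) as [Htk|Htk].
  - rewrite Hg by trivial.
    assert (Hq := Hlim (t + k)). simpl in Hq. unfold Rdist in Hq.
    replace (t + k - t) with k in Hq by ring.
    apply Hq. split; [|trivial]. split; [|lra].
    split; simpl; lra.
  - assert (t = 0) by lra. subst t.
    unfold g. rewrite Rplus_0_l. rewrite Rplus_0_l in Htk.
    destruct (Rle_dec 0 k) as [Hk0|_]; [lra|].
    replace ((f 0 + f' 0 * k - f 0) / k - f' 0) with 0 by (field; trivial).
    now rewrite Rabs_R0.
Qed.

(** * Reduction of the Einstein-scalar field system *)

Definition reduced_force (rho0 kappa x : R) : R :=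
  - (16 * PI * rho0) * exp (- (4 / 3) * x) - kappa * exp (- 2 * x).

Lemma reduced_force_lipschitz (rho0 kappa : R) :
  locally_lipschitz (reduced_force rho0 kappa).
Proof.
  apply locally_lipschitz_C1 with (fun x =>
    64 / 3 * PI * rho0 * exp (- (4 / 3) * x) + 2 * kappa * exp (- 2 * x)).
  - intros x. unfold reduced_force. auto_derive; [easy|field].
  - intros x. apply (@ex_derive_continuous R_AbsRing R_NormedModule).
    now auto_derive.
Qed.

(** The quotient [f / g] has zero derivative, so it keeps its initial value 1. This determines the
    scale factors from their logarithmic derivatives. *)
Lemma log_derivative_unique (f g k : R -> R) (T : R) :
  (forall t, 0 <= t < T -> 0 < g t) ->
  (forall t, 0 <= t < T -> is_derive f t (f t * k t)) ->
  (forall t, 0 <= t < T -> is_derive g t (g t * k t)) ->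
  f 0 = g 0 -> forall t, 0 <= t < T -> f t = g t.
Proof.
  intros Hpos Hf Hg H0 t Ht.
  assert (Hq : f t / g t = f 0 / g 0).
  { apply (constant_on_interval (fun t => f t / g t) T); trivial.
    intros s Hs. assert (Hs' := Hpos s Hs).
    assert (E1 := Hf s Hs). assert (E2 := Hg s Hs).
    auto_derive.
    - repeat split; try (eexists; eassumption). lra.
    - rewrite_derivatives. field. lra. }
  assert (Ht' := Hpos t Ht). assert (H0' := Hpos 0 ltac:(lra)).
  rewrite H0, Rdiv_diag in Hq by lra.
  apply Rmult_eq_reg_r with (/ g t); [|apply Rinv_neq_0_compat; lra].
  fold (f t / g t). rewrite Hq. field; lra.
Qed.

Lemma equal_derivatives_unique (f g k : R -> R) (T : R) :
  (forall t, 0 <= t < T -> is_derive f t (k t)) ->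
  (forall t, 0 <= t < T -> is_derive g t (k t)) ->
  f 0 = g 0 -> forall t, 0 <= t < T -> f t = g t.
Proof.
  intros Hf Hg H0 t Ht. apply Rminus_diag_uniq.
  rewrite <- (Rminus_diag_eq _ _ H0).
  apply (constant_on_interval (fun t => f t - g t) T); trivial.
  intros s Hs. rewrite <- (Rminus_diag (k s)).
  apply (is_derive_minus f g); auto.
Qed.

Section Reduction.

Variables Lambda a0 da0 b0 db0 phi0 dphi0 rho0 : R.
Hypothesis a0_pos : 0 < a0.
Hypothesis b0_pos : 0 < b0.
Hypothesis dphi0_pos : 0 < dphi0.

Let d := da0 / a0 - db0 / b0.
Let force := reduced_force rho0 (d ^ 2 + 12 * PI * dphi0 ^ 2).

(** [m] is the logarithm of the relative volume [a b^2 / (a0 b0^2)], and [h = m'] is the expansion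
    [a'/a + 2 b'/b]. *)
Definition reduced_solution (T : R) (m h : R -> R) : Prop :=
  m 0 = 0 /\ h 0 = da0 / a0 + 2 * (db0 / b0) /\
  forall t, 0 <= t < T -> is_derive m t (h t) /\ is_derive h t (force (m t)).

(** The factors of [a] and [b] solve [x + 2y = h], [x - y = d e^{-m}] for [x = a'/a] and [y = b'/b].
    The derivative of [rho] is listed separately because a formula on [[0, T)] alone does not give a
    two-sided derivative at 0. *)
Definition reconstructed (T : R) (m h a b rho phi : R -> R) : Prop :=
  a 0 = a0 /\ b 0 = b0 /\ phi 0 = phi0 /\
  forall t, 0 <= t < T ->
    0 < a t /\ 0 < b t /\ rho t = rho0 * exp (- (4 / 3) * m t) /\
    is_derive a t (a t * ((h t + 2 * d * exp (- m t)) / 3)) /\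
    is_derive b t (b t * ((h t - d * exp (- m t)) / 3)) /\
    is_derive phi t (dphi0 * exp (- m t)) /\
    is_derive rho t (- (4 / 3) * h t * rho t).

(** * Solving the scalar equation and reconstructing the unknowns *)

Lemma reduced_solution_exists : exists T : R, 0 < T /\
  exists m h, reduced_solution T m h /\ (forall t, continuous m t).
Proof.
  destruct (ode2_existence force 0 (da0 / a0 + 2 * (db0 / b0))
              (reduced_force_lipschitz _ _))
    as [T [HT [m [h [H0 [H0' [Hm Hh]]]]]]].
  exists T; split; trivial. exists m, h. split.
  - split; [|split]; trivial. intros t Ht. split; trivial.
    apply Hh. rewrite Rabs_pos_eq; lra.
  - intros t. now apply derive_continuous with (h t).
Qed.

Lemma reconstruction_exists (T : R) (m h : R -> R) :
  reduced_solution T m h -> (forall t, continuous m t) ->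
  exists a b rho phi, reconstructed T m h a b rho phi.
Proof.
  intros [H0 [_ Hm]] Hc.
  (* With [J' = e^{-m}], the logarithmic derivatives integrate explicitly: [ln (a/a0) = m/3 + 2dJ/3]
     and [ln (b/b0) = m/3 - dJ/3]. *)
  set (J := fun t => RInt (fun s => exp (- m s)) 0 t).
  assert (HJ0 : J 0 = 0) by apply (@RInt_point R_CompleteNormedModule).
  assert (HJ : forall t, is_derive J t (exp (- m t))).
  { intros t. apply (is_derive_primitive (fun s => exp (- m s))).
    intros s. apply (continuous_comp (fun s => - m s) exp).
    - apply (continuous_opp m), Hc.
    - apply continuity_pt_filterlim, derivable_continuous_pt, derivable_pt_exp. }
  exists (fun t => a0 * exp (m t / 3 + 2 / 3 * d * J t)),
    (fun t => b0 * exp (m t / 3 - / 3 * d * J t)),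
    (fun t => rho0 * exp (- (4 / 3) * m t)), (fun t => phi0 + dphi0 * J t).
  split; [|split; [|split]].
  1-2: rewrite H0, HJ0, <- Rmult_1_r; f_equal; rewrite <- exp_0; f_equal; field.
  - rewrite HJ0; ring.
  - intros t Ht. destruct (Hm t Ht) as [E1 _]. assert (E2 := HJ t).
    split; [|split; [|split; [|split; [|split; [|split]]]]]; trivial.
    1-2: apply Rmult_lt_0_compat; [trivial|apply exp_pos].
    all: auto_derive;
      [repeat split; eexists; eassumption|rewrite_derivatives; unfold Rminus, Rdiv; field].
Qed.

(** The scalar equation fixes [m] and [h]; then [rho] is explicit in [m], the logarithmic
    derivatives of [a] and [b] are fixed, and so is the derivative of [phi]. *)
Lemma reconstruction_unique (T : R)
    (m1 h1 a1 b1 rho1 phi1 m2 h2 a2 b2 rho2 phi2 : R -> R) :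
  reduced_solution T m1 h1 -> reconstructed T m1 h1 a1 b1 rho1 phi1 ->
  reduced_solution T m2 h2 -> reconstructed T m2 h2 a2 b2 rho2 phi2 ->
  forall t, 0 <= t < T ->
    a1 t = a2 t /\ b1 t = b2 t /\ rho1 t = rho2 t /\ phi1 t = phi2 t.
Proof.
  intros [M1 [H1 E1]] [A1 [B1 [P1 R1]]] [M2 [H2 E2]] [A2 [B2 [P2 R2]]].
  assert (Heq : forall t, 0 <= t < T -> m1 t = m2 t /\ h1 t = h2 t).
  { apply ode2_uniqueness with force; try congruence;
      try apply reduced_force_lipschitz; intros; try now apply E1.
    all: now apply E2. }
  intros t Ht. split; [|split; [|split]].
  - apply (log_derivative_unique a1 a2 (fun t => (h2 t + 2 * d * exp (- m2 t)) / 3) T);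
      trivial; try congruence; intros s Hs.
    1,3: now apply R2.
    destruct (Heq s Hs) as [<- <-]. now apply R1.
  - apply (log_derivative_unique b1 b2 (fun t => (h2 t - d * exp (- m2 t)) / 3) T);
      trivial; try congruence; intros s Hs.
    1,3: now apply R2.
    destruct (Heq s Hs) as [<- <-]. now apply R1.
  - destruct (R1 t Ht) as [_ [_ [-> _]]], (R2 t Ht) as [_ [_ [-> _]]].
    now destruct (Heq t Ht) as [-> _].
  - apply (equal_derivatives_unique phi1 phi2 (fun t => dphi0 * exp (- m2 t)) T);
      trivial; try congruence; intros s Hs.
    2: now apply R2.
    destruct (Heq s Hs) as [<- _]. now apply R1.
Qed.

(** * The energy integral and verification of the system *)

Lemma exp_double (x : R) : exp (- 2 * x) = exp (- x) ^ 2.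
Proof. rewrite <- Rsqr_pow2. unfold Rsqr. rewrite <- exp_plus. f_equal; ring. Qed.

(** The energy [e] is conserved by the scalar equation. Its initial value is [3 Lambda] by the
    initial constraint, since [(x + 2y)^2 - (x - y)^2 = 3 (y^2 + 2xy)]; this is how [Lambda], absent
    from the scalar equation, re-enters. *)
Lemma reduced_energy (T : R) (m h : R -> R) :
  hamiltonian_constraint Lambda a0 da0 b0 db0 dphi0 rho0 ->
  reduced_solution T m h ->
  forall t, 0 <= t < T ->
    h t ^ 2 = 3 * Lambda + 24 * PI * rho0 * exp (- (4 / 3) * m t)
      + (d ^ 2 + 12 * PI * dphi0 ^ 2) * exp (- m t) ^ 2.
Proof.
  intros Hc [H0 [H0' Hm]] t Ht.
  set (e := fun t => h t ^ 2 - 24 * PI * rho0 * exp (- (4 / 3) * m t)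
    - (d ^ 2 + 12 * PI * dphi0 ^ 2) * exp (- 2 * m t)).
  assert (He : e t = e 0).
  { apply (constant_on_interval e T); trivial.
    intros s Hs. destruct (Hm s Hs) as [E1 E2]. unfold e. auto_derive.
    - repeat split; eexists; eassumption.
    - rewrite_derivatives. unfold force, reduced_force. field. }
  unfold e in He.
  rewrite H0, H0', !Rmult_0_r, exp_0, exp_double in He.
  unfold hamiltonian_constraint in Hc.
  unfold d in *. lra.
Qed.

Lemma reconstructed_is_solution (T : R) (m h a b rho phi : R -> R) :
  0 < T -> 0 <= rho0 ->
  hamiltonian_constraint Lambda a0 da0 b0 db0 dphi0 rho0 ->
  reduced_solution T m h -> reconstructed T m h a b rho phi ->
  is_solution Lambda T a0 da0 b0 db0 phi0 dphi0 rho0 a b rho phi.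
Proof.
  intros HT Hrho Hc Hred [A0 [B0 [P0 Hrec]]].
  assert (Hen := reduced_energy T m h Hc Hred).
  destruct Hred as [H0 [H0' Hm]].
  (* The second derivatives come from [a'' = a (x^2 + x')] and [b'' = b (y^2 + y')], with
     [h' = force m] and [(e^{-m})' = - h e^{-m}]. *)
  exists (fun t => a t * ((h t + 2 * d * exp (- m t)) / 3)),
    (fun t => a t * (((h t + 2 * d * exp (- m t)) / 3) ^ 2
      + (force (m t) - 2 * d * exp (- m t) * h t) / 3)),
    (fun t => b t * ((h t - d * exp (- m t)) / 3)),
    (fun t => b t * (((h t - d * exp (- m t)) / 3) ^ 2
      + (force (m t) + d * exp (- m t) * h t) / 3)),
    (fun t => dphi0 * exp (- m t)),
    (fun t => - dphi0 * exp (- m t) * h t),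
    (fun t => - (4 / 3) * h t * rho t).
  assert (HD : forall t, interval T t -> is_derive m t (h t)
    /\ is_derive h t (force (m t))
    /\ is_derive a t (a t * ((h t + 2 * d * exp (- m t)) / 3))
    /\ is_derive b t (b t * ((h t - d * exp (- m t)) / 3))
    /\ is_derive phi t (dphi0 * exp (- m t))
    /\ is_derive rho t (- (4 / 3) * h t * rho t)).
  { intros t Ht. destruct (Hm t Ht) as [? ?].
    destruct (Hrec t Ht) as [_ [_ [_ [? [? [? ?]]]]]]. repeat (split; [assumption|]); assumption. }
  split; [|split; [|split; [|split; [|split]]]].
  1-3: split.
  1-7: apply is_C1_on_intro; intros t Ht;
    destruct (HD t Ht) as [E1 [E2 [E3 [E4 [E5 E6]]]]]; trivial.
  (* What remains are the derivatives of the first derivatives and all continuity goals; continuity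
     is deduced from differentiability. *)
  1-10: unfold force, reduced_force;
    try apply (@ex_derive_continuous R_AbsRing R_NormedModule);
    auto_derive; [repeat split; eexists; eassumption|..];
    rewrite_derivatives; unfold force, reduced_force; field.
  - intros t Ht. destruct (Hrec t Ht) as [Ha [Hb [Hr _]]].
    assert (Ht' := Hen t Ht). rewrite Hr.
    assert (HE := exp_pos (- m t)). assert (HR := exp_pos (- (4 / 3) * m t)).
    unfold hamiltonian_constraint, evolution_b, evolution_a, evolution_phi, evolution_rho.
    unfold force, reduced_force. rewrite exp_double.
    set (E := exp (- m t)) in *. set (R := exp (- (4 / 3) * m t)) in *.
    split; [trivial|]. split; [trivial|].
    split; [apply Rmult_le_pos; lra|].
    split; [apply Rmult_le_pos; lra|].
    (* Once the scale factors cancel, the equations are polynomial in [h], [E] and [R], and each is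
       an identity or a linear consequence of the energy relation [Ht']. *)
    assert (Hdiv : forall u v, 0 < u -> u * v / u = v) by (intros; field; lra).
    rewrite !Hdiv by trivial.
    replace (a t * ((h t + 2 * d * E) / 3) * (b t * ((h t - d * E) / 3)) / (a t * b t))
      with ((h t + 2 * d * E) / 3 * ((h t - d * E) / 3)) by (field; lra).
    repeat split; lra.
  - rewrite H0, H0', Ropp_0, exp_0. unfold d.
    destruct (Hrec 0 ltac:(lra)) as [_ [_ [Hr0 _]]].
    rewrite A0, B0, P0, Hr0, H0, Rmult_0_r, exp_0.
    repeat split; field; lra.
Qed.

(** * From an arbitrary solution to the scalar equation *)

Lemma solution_reduces (T : R) (a b rho phi : R -> R) :
  0 < T -> is_solution Lambda T a0 da0 b0 db0 phi0 dphi0 rho0 a b rho phi ->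
  exists A B Rho Phi m h : R -> R,
    reduced_solution T m h /\ reconstructed T m h A B Rho Phi /\
    forall t, 0 <= t < T -> A t = a t /\ B t = b t /\ Rho t = rho t /\ Phi t = phi t.
Proof.
  intros HT (a' & a'' & b' & b'' & p' & p'' & r' & [Ca Ca'] & [Cb Cb'] & [Cp Cp']
    & Cr & Heq & Ia & Ia' & Ib & Ib' & Ip & Ip' & Ir).
  (* Each function and its first derivative are extended separately. On [[0, T)], [A] has derivative
     [a'], which [A'] equals there; nothing relates [A'] to [A] at negative times. *)
  destruct (is_C1_on_extension T a a' Ca) as [A HA].
  destruct (is_C1_on_extension T a' a'' Ca') as [A' HA'].
  destruct (is_C1_on_extension T b b' Cb) as [B HB].
  destruct (is_C1_on_extension T b' b'' Cb') as [B' HB'].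
  destruct (is_C1_on_extension T phi p' Cp) as [P HP].
  destruct (is_C1_on_extension T p' p'' Cp') as [P' HP'].
  destruct (is_C1_on_extension T rho r' Cr) as [R HR].
  assert (Z : 0 <= 0 < T) by lra.
  set (x := fun t => A' t / A t). set (y := fun t => B' t / B t).
  set (h := fun t => x t + 2 * y t).
  set (m := fun t => ln (A t) + 2 * ln (B t) - (ln a0 + 2 * ln b0)).
  assert (Hpos : forall t, 0 <= t < T -> 0 < A t /\ 0 < B t).
  { intros t Ht. destruct (HA t Ht) as [-> _], (HB t Ht) as [-> _].
    destruct (Heq t Ht) as [? [? _]]. now split. }
  assert (HdA : forall t, 0 <= t < T -> is_derive A t (A t * x t)).
  { intros t Ht. destruct (Hpos t Ht). unfold x.
    replace (A t * (A' t / A t)) with (A' t) by (field; lra).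
    destruct (HA' t Ht) as [-> _]. now apply HA. }
  assert (HdB : forall t, 0 <= t < T -> is_derive B t (B t * y t)).
  { intros t Ht. destruct (Hpos t Ht). unfold y.
    replace (B t * (B' t / B t)) with (B' t) by (field; lra).
    destruct (HB' t Ht) as [-> _]. now apply HB. }
  assert (Hm : forall t, 0 <= t < T -> is_derive m t (h t)).
  { intros t Ht. destruct (Hpos t Ht).
    assert (E1 := HdA t Ht). assert (E2 := HdB t Ht). unfold m. auto_derive.
    - repeat split; try (eexists; eassumption); trivial.
    - rewrite_derivatives. unfold h. field; lra. }
  assert (Hm0 : m 0 = 0).
  { unfold m. destruct (HA 0 Z) as [-> _], (HB 0 Z) as [-> _].
    rewrite Ia, Ib. ring. }
  assert (Hsys : forall t, 0 <= t < T ->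
    y t ^ 2 + 2 * x t * y t - Lambda = 8 * PI * R t + 4 * PI * P' t ^ 2 /\
    y t ^ 2 + 2 * (b'' t / B t) - Lambda = - (8 * PI * R t / 3) - 4 * PI * P' t ^ 2 /\
    a'' t / A t + x t * y t + b'' t / B t - Lambda
      = - (8 * PI * R t / 3) - 4 * PI * P' t ^ 2 /\
    p'' t * P' t + h t * P' t ^ 2 = 0 /\
    r' t = - (4 / 3) * h t * R t /\ 0 <= P' t).
  { intros t Ht. destruct (Hpos t Ht). unfold h, x, y.
    destruct (Heq t Ht) as [_ [_ [_ [Hp [Q1 [Q2 [Q3 [Q4 Q5]]]]]]]].
    destruct (HA t Ht) as [EA _], (HB t Ht) as [EB _], (HA' t Ht) as [EA' _],
      (HB' t Ht) as [EB' _], (HP' t Ht) as [EP' _], (HR t Ht) as [ER _].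
    unfold hamiltonian_constraint, evolution_b, evolution_a, evolution_phi, evolution_rho in *.
    rewrite <- EA, <- EB, <- EA', <- EB', <- EP', <- ER in *.
    replace (A' t * B' t / (A t * B t)) with (A' t / A t * (B' t / B t)) in Q3
      by (field; lra).
    repeat split; lra. }
  (* The equation [(V x)' = V (Lambda + 8 PI rho / 3)] divided by [V = a b^2]: the constraint and
     the equation for [b''] eliminate [dphi^2] and [b''] from the equation for [a'']. *)
  assert (Hx : forall t, 0 <= t < T ->
    is_derive x t (Lambda + 8 * PI * R t / 3 - x t * h t)).
  { intros t Ht. destruct (Hpos t Ht). destruct (Hsys t Ht) as [Q1 [Q2 [Q3 _]]].
    assert (E1 := HdA t Ht). destruct (HA' t Ht) as [_ E2].
    replace (Lambda + 8 * PI * R t / 3 - x t * h t) with (a'' t / A t - x t ^ 2)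
      by (unfold h; lra).
    unfold x at 1. auto_derive.
    - repeat split; try (eexists; eassumption). lra.
    - rewrite_derivatives. unfold x. field. lra. }
  assert (Hy : forall t, 0 <= t < T ->
    is_derive y t (Lambda + 8 * PI * R t / 3 - y t * h t)).
  { intros t Ht. destruct (Hpos t Ht). destruct (Hsys t Ht) as [Q1 [Q2 _]].
    assert (E1 := HdB t Ht). destruct (HB' t Ht) as [_ E2].
    replace (Lambda + 8 * PI * R t / 3 - y t * h t) with (b'' t / B t - y t ^ 2)
      by (unfold h; lra).
    unfold y at 1. auto_derive.
    - repeat split; try (eexists; eassumption). lra.
    - rewrite_derivatives. unfold y. field. lra. }
  assert (Hxy : forall t, 0 <= t < T -> x t - y t = d * exp (- m t)).
  { intros t Ht.
    (* Subtracting [Hy] from [Hx] leaves [(x - y)' = - h (x - y)], and [h = m']. *)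
    assert (Hq : (x t - y t) * exp (m t) = (x 0 - y 0) * exp (m 0)).
    { apply (constant_on_interval (fun t => (x t - y t) * exp (m t)) T); trivial.
      intros s Hs. assert (E1 := Hx s Hs). assert (E2 := Hy s Hs). assert (E3 := Hm s Hs).
      auto_derive; [repeat split; eexists; eassumption|].
      rewrite_derivatives. field. }
    assert (Hd0 : x 0 - y 0 = d).
    { unfold x, y. destruct (HA 0 Z) as [-> _], (HB 0 Z) as [-> _],
        (HA' 0 Z) as [-> _], (HB' 0 Z) as [-> _].
      rewrite Ia, Ib, Ia', Ib'. reflexivity. }
    rewrite Hm0, exp_0, Hd0, Rmult_1_r in Hq.
    rewrite <- Hq, Rmult_assoc, <- exp_plus, Rplus_opp_r, exp_0. ring. }
  assert (HRm : forall t, 0 <= t < T -> R t = rho0 * exp (- (4 / 3) * m t)).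
  { intros t Ht.
    assert (Hq : R t * exp (4 / 3 * m t) = R 0 * exp (4 / 3 * m 0)).
    { apply (constant_on_interval (fun t => R t * exp (4 / 3 * m t)) T); trivial.
      intros s Hs. destruct (HR s Hs) as [_ E1]. assert (E2 := Hm s Hs).
      destruct (Hsys s Hs) as [_ [_ [_ [_ [Er _]]]]].
      auto_derive; [repeat split; eexists; eassumption|].
      rewrite_derivatives. rewrite Er. field. }
    assert (HR0 : R 0 = rho0) by (destruct (HR 0 Z) as [-> _]; trivial).
    rewrite Hm0, Rmult_0_r, exp_0, HR0, Rmult_1_r in Hq.
    rewrite <- Hq, Rmult_assoc, <- exp_plus.
    replace (4 / 3 * m t + - (4 / 3) * m t) with 0 by ring.
    rewrite exp_0. ring. }
  assert (HPm : forall t, 0 <= t < T -> P' t = dphi0 * exp (- m t)).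
  { intros t Ht.
    (* The field equation carries a factor [dphi], so it yields conservation of the square only; the
       root is then taken using [0 <= P' t] and [0 < dphi0]. *)
    assert (Hq : (P' t * exp (m t)) ^ 2 = (P' 0 * exp (m 0)) ^ 2).
    { apply (constant_on_interval (fun t => (P' t * exp (m t)) ^ 2) T); trivial.
      intros s Hs. destruct (HP' s Hs) as [_ E1]. assert (E2 := Hm s Hs).
      destruct (Hsys s Hs) as [_ [_ [_ [Ep _]]]].
      auto_derive; [repeat split; eexists; eassumption|].
      rewrite_derivatives.
      transitivity (2 * exp (m s) ^ 2 * (p'' s * P' s + h s * P' s ^ 2)); [ring|].
      rewrite Ep; ring. }
    assert (HP0 : P' 0 = dphi0) by (destruct (HP' 0 Z) as [-> _]; trivial).
    rewrite Hm0, exp_0, Rmult_1_r, HP0, <- !Rsqr_pow2 in Hq.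
    destruct (Hsys t Ht) as [_ [_ [_ [_ [_ Hp]]]]].
    apply Rsqr_inj in Hq; [| |lra].
    - rewrite <- Hq, Rmult_assoc, <- exp_plus, Rplus_opp_r, exp_0. ring.
    - apply Rmult_le_pos; [trivial|apply Rlt_le, exp_pos]. }
  exists A, B, R, P, m, h.
  split; [|split].
  - split; [|split]; trivial.
    + unfold h, x, y. destruct (HA 0 Z) as [-> _], (HB 0 Z) as [-> _],
        (HA' 0 Z) as [-> _], (HB' 0 Z) as [-> _].
      now rewrite Ia, Ib, Ia', Ib'.
    + intros t Ht. split; [now apply Hm|].
      assert (E1 := Hx t Ht). assert (E2 := Hy t Ht).
      destruct (Hsys t Ht) as [Q1 _].
      assert (HRt := HRm t Ht). assert (HPt := HPm t Ht). assert (Hxyt := Hxy t Ht).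
      (* The replacing expression is [x' + 2y']. It equals the force because the constraint and
         [x - y = d e^{-m}] express [h^2 = 3 (y^2 + 2xy) + (x - y)^2] through [Lambda], [rho] and
         [m]. *)
      replace (force (m t)) with
        (3 * Lambda + 8 * PI * R t - h t ^ 2).
      { unfold h at 1. auto_derive; [repeat split; eexists; eassumption|].
        rewrite_derivatives. unfold h. field. }
      unfold force, reduced_force.
      rewrite exp_double, HRt. rewrite HRt, HPt in Q1.
      assert (Hsq : (x t - y t) ^ 2 = d ^ 2 * exp (- m t) ^ 2) by (rewrite Hxyt; ring).
      unfold h. lra.
  - split; [|split; [|split]].
    + destruct (HA 0 Z) as [-> _]; trivial.
    + destruct (HB 0 Z) as [-> _]; trivial.
    + destruct (HP 0 Z) as [-> _]; trivial.
    + intros t Ht. destruct (Hpos t Ht). assert (Hxyt := Hxy t Ht).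
      repeat (split; [trivial; now apply HRm|]).
      replace ((h t + 2 * d * exp (- m t)) / 3) with (x t) by (unfold h; lra).
      replace ((h t - d * exp (- m t)) / 3) with (y t) by (unfold h; lra).
      split; [now apply HdA|]. split; [now apply HdB|].
      destruct (Hsys t Ht) as [_ [_ [_ [_ [Er _]]]]].
      rewrite <- Er, <- HPm by trivial. destruct (HP' t Ht) as [-> _].
      split; [now apply HP|now apply HR].
  - intros t Ht. repeat split; [now apply HA|now apply HB|now apply HR|now apply HP].
Qed.

End Reduction.

(** * Local existence and uniqueness for the full system *)

Theorem theorem4p2 (Lambda a0 da0 b0 db0 phi0 dphi0 rho0 : R)
    (ha0 : 0 < a0) (hb0 : 0 < b0) (hdphi0 : 0 < dphi0) (hrho0 : 0 <= rho0)
    (hconstraint : hamiltonian_constraint Lambda a0 da0 b0 db0 dphi0 rho0) :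
  exists T : R, 0 < T /\
    exists a b rho phi : R -> R,
      is_solution Lambda (Finite T) a0 da0 b0 db0 phi0 dphi0 rho0 a b rho phi /\
      forall a1 b1 rho1 phi1 : R -> R,
        is_solution Lambda (Finite T) a0 da0 b0 db0 phi0 dphi0 rho0
          a1 b1 rho1 phi1 ->
        forall t : R, interval (Finite T) t ->
          a1 t = a t /\ b1 t = b t /\ rho1 t = rho t /\ phi1 t = phi t.
Proof.
  destruct (reduced_solution_exists a0 da0 b0 db0 dphi0 rho0)
    as [T [HT [m [h [Hred Hm]]]]].
  destruct (reconstruction_exists a0 da0 b0 db0 phi0 dphi0 rho0 ha0 hb0 T m h Hred Hm)
    as [a [b [rho [phi Hrec]]]].
  exists T. split; trivial. exists a, b, rho, phi. split.
  - now apply reconstructed_is_solution with m h.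
  - intros a1 b1 rho1 phi1 Hsol t Ht.
    destruct (solution_reduces Lambda a0 da0 b0 db0 phi0 dphi0 rho0
                hdphi0 T a1 b1 rho1 phi1 HT Hsol)
      as [A [B [Rho [Phi [m1 [h1 [Hred1 [Hrec1 Heq]]]]]]]].
    (* The competing solution is replaced at time [t] by its extensions, which have two-sided
       derivatives and so can be compared with the reconstruction. *)
    destruct (Heq t Ht) as [<- [<- [<- <-]]].
    exact (reconstruction_unique _ _ _ _ _ _ _ _ _ _ _ _ _ _ _ _ _ _ _ _
             Hred1 Hrec1 Hred Hrec t Ht).
Qed.
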